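(* For rational numbers $f,g$ and a list of coefficients write $$[c_0,c_1,\dots,c_{10}]=\sum_{j=0}^{10}c_jf^{10-j}g^{j}.$$ For all rational numbers $f,g$, define $$\begin{aligned} x_1&=[1701,3888,459,1656,-5310,2504,-1482,616,25,-24,-1],\\ x_2&=[243,1944,4509,-5256,-1314,-3112,42,40,-17,48,-7],\\ x_3&=[-1215,-972,2403,1872,4770,4088,798,208,157,-12,-1],\\ x_4&=[-1215,-2916,459,1656,4122,-832,1878,-248,-59,36,-1],\\ x_5&=[243,972,-3591,-936,126,-1600,354,-728,-17,-12,5],\\ x_6&=[243,-2916,-4239,1008,-2394,-1048,-1590,112,-89,-36,5],\\ y_1&=[243,-1944,-675,5544,4446,2504,1770,184,-17,48,-7],\\ y_2&=[-1215,-972,459,-6552,-1062,-1600,-42,-104,133,12,-1],\\ y_3&=[243,-972,-4239,1872,-2394,4088,-1590,208,-89,-12,5],\\ y_4&=[243,2916,1593,-2232,-5634,-832,-1374,184,-17,-36,5],\\ y_5&=[1701,3888,459,360,-126,-3112,438,-584,-167,24,-1],\\ y_6&=[-1215,-2916,2403,1008,4770,-1048,798,112,157,-36,-1]. \end{aligned}$$ Then $\sum_{i=1}^6x_i=\sum_{i=1}^6y_i=0$ and $$\sum_{i=1}^6x_i^r=\sum_{i=1}^6y_i^r\qquad\text{for } r=1,2,3,4,5,7.$$ Moreover, as a parametric solution this is nontrivial and nonsymmetric: in $\mathbb{Q}[f,g]$ the multisets $\{x_1,\dots,x_6\}$ and $\{y_1,\dots,y_6\}$ are distinct, and it is not the case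 that both $\{x_1,\dots,x_6\}=\{-x_1,\dots,-x_6\}$ and $\{y_1,\dots,y_6\}=\{-y_1,\dots,-y_6\}$ as multisets.
   Context: An ideal solution of the Tarry-Escott problem of degree $k$ consists of two distinct multisets $\{x_1,\dots,x_{k+1}\}$, $\{y_1,\dots,y_{k+1}\}$ with $\sum x_i^r=\sum y_i^r$ for $r=1,\dots,k$. For $k=5$, a solution with $\sum x_i=\sum y_i=0$ is symmetric if, after rearrangement, $x_i=-x_{7-i}$ and $y_i=-y_{7-i}$ for $i=1,2,3$, and nonsymmetric otherwise. *)

(* Defs.v *)
From HB Require Import structures.
From mathcomp Require Import all_boot all_order all_algebra.
From mathcomp Require Export mpoly.
Set Implicit Arguments.
Unset Strict Implicit.
Unset Printing Implicit Defensive.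
Import GRing.Theory.
Local Open Scope ring_scope.

(* [c_0, ..., c_10] evaluated at f, g.  The ring R is left generic
   so that the same forms can be read both as rational numbers (f, g : rat)
   and as elements of Q[f, g]. *)
Definition bform (R : comNzRingType) (c : seq int) (f g : R) : R :=
  \sum_(j < 11) (c`_j)%:~R * f ^+ (10 - j) * g ^+ j.

Definition xcoefs : seq (seq int) :=
  [:: [:: 1701; 3888; 459; 1656; -5310; 2504; -1482; 616; 25; -24; -1];
      [:: 243; 1944; 4509; -5256; -1314; -3112; 42; 40; -17; 48; -7];
      [:: -1215; -972; 2403; 1872; 4770; 4088; 798; 208; 157; -12; -1];
      [:: -1215; -2916; 459; 1656; 4122; -832; 1878; -248; -59; 36; -1];
      [:: 243; 972; -3591; -936; 126; -1600; 354; -728; -17; -12; 5];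
      [:: 243; -2916; -4239; 1008; -2394; -1048; -1590; 112; -89; -36; 5]].

Definition ycoefs : seq (seq int) :=
  [:: [:: 243; -1944; -675; 5544; 4446; 2504; 1770; 184; -17; 48; -7];
      [:: -1215; -972; 459; -6552; -1062; -1600; -42; -104; 133; 12; -1];
      [:: 243; -972; -4239; 1872; -2394; 4088; -1590; 208; -89; -12; 5];
      [:: 243; 2916; 1593; -2232; -5634; -832; -1374; 184; -17; -36; 5];
      [:: 1701; 3888; 459; 360; -126; -3112; 438; -584; -167; 24; -1];
      [:: -1215; -2916; 2403; 1008; 4770; -1048; 798; 112; 157; -36; -1]].

Definition xs (R : comNzRingType) (f g : R) : seq R :=
  [seq bform c f g | c <- xcoefs].

Definition ys (R : comNzRingType) (f g : R) : seq R :=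
  [seq bform c f g | c <- ycoefs].

(* Finite sequences stand for multisets: equality of multisets is perm_eq, and
   -{x_1, ..., x_n} is the sequence of opposites. *)
Definition symmetric_multiset (R : comNzRingType) (s : seq R) : bool :=
  perm_eq s [seq - x | x <- s].

Definition Xf : {mpoly rat[2]} := 'X_0.
Definition Xg : {mpoly rat[2]} := 'X_1.

(* Main.v *)
(** The power-sum identities are polynomial identities in [f] and [g], valid in
    every commutative ring.  For the last two claims it suffices to follow the
    coefficient of [f g^9]: the value [-24] occurs among the [x_i], but neither
    among the [y_i] nor among the [- x_i]. *)
Require Import Defs.
From mathcomp Require Import all_boot all_order all_algebra.
From mathcomp Require Import mpoly ring.
Import GRing.Theory Num.Theory.
Local Open Scope ring_scope.

(** Turns the sum over ordinals into an explicit polynomial expression, which [ring] can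
    normalise. *)
Lemma bformE (R : comNzRingType) (f g : R)
    (a0 a1 a2 a3 a4 a5 a6 a7 a8 a9 a10 : int) :
  bform [:: a0; a1; a2; a3; a4; a5; a6; a7; a8; a9; a10] f g =
  a0%:~R * f ^+ 10 + a1%:~R * f ^+ 9 * g + a2%:~R * f ^+ 8 * g ^+ 2
  + a3%:~R * f ^+ 7 * g ^+ 3 + a4%:~R * f ^+ 6 * g ^+ 4
  + a5%:~R * f ^+ 5 * g ^+ 5 + a6%:~R * f ^+ 4 * g ^+ 6
  + a7%:~R * f ^+ 3 * g ^+ 7 + a8%:~R * f ^+ 2 * g ^+ 8
  + a9%:~R * f * g ^+ 9 + a10%:~R * g ^+ 10.
Proof. by rewrite /bform !big_ord_recr big_ord0 /= add0r !expr1 !mulr1. Qed.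

(** [unlock] exposes the big operator as a fold, so that [/=] can compute the sum over the six
    concrete forms. *)
Ltac expand_forms := rewrite unlock /xs /ys /= !bformE.

Lemma sum_xs (R : comNzRingType) (f g : R) : \sum_(x <- xs f g) x = 0.
Proof. by expand_forms; ring. Qed.

Lemma sum_ys (R : comNzRingType) (f g : R) : \sum_(y <- ys f g) y = 0.
Proof. by expand_forms; ring. Qed.

Lemma sum_expr1 (R : comNzRingType) (f g : R) :
  \sum_(x <- xs f g) x ^+ 1 = \sum_(y <- ys f g) y ^+ 1.
Proof. by expand_forms; ring. Qed.

Lemma sum_expr2 (R : comNzRingType) (f g : R) :
  \sum_(x <- xs f g) x ^+ 2 = \sum_(y <- ys f g) y ^+ 2.
Proof. by expand_forms; ring. Qed.

Lemma sum_expr3 (R : comNzRingType) (f g : R) :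
  \sum_(x <- xs f g) x ^+ 3 = \sum_(y <- ys f g) y ^+ 3.
Proof. by expand_forms; ring. Qed.

Lemma sum_expr4 (R : comNzRingType) (f g : R) :
  \sum_(x <- xs f g) x ^+ 4 = \sum_(y <- ys f g) y ^+ 4.
Proof. by expand_forms; ring. Qed.

Lemma sum_expr5 (R : comNzRingType) (f g : R) :
  \sum_(x <- xs f g) x ^+ 5 = \sum_(y <- ys f g) y ^+ 5.
Proof. by expand_forms; ring. Qed.

Lemma sum_expr7 (R : comNzRingType) (f g : R) :
  \sum_(x <- xs f g) x ^+ 7 = \sum_(y <- ys f g) y ^+ 7.
Proof. by expand_forms; ring. Qed.

Definition bimon (a b : nat) : 'X_{1..2} :=
  [multinom (if i == ord0 then a else b) | i < 2].

Lemma bimon_inj (a b c d : nat) : bimon a b = bimon c d -> a = c /\ b = d.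
Proof.
move=> /mnmP e; split; first by have := e ord0; rewrite !mnmE.
by have := e ord_max; rewrite !mnmE.
Qed.

Lemma XfXgE (a b : nat) : Xf ^+ a * Xg ^+ b = 'X_[bimon a b].
Proof.
rewrite /Xf /Xg !mpolyXn -mpolyXD; congr mpolyX; apply/mnmP => i.
rewrite mnmDE !mulmnE !mnm1E mnmE.
by case: i => [[|[|//]] ?] /=; rewrite mul1n mul0n ?addn0.
Qed.

(** The eleven monomials of a form have distinct exponents, so the [j]-th one receives a
    contribution from the [j]-th term only. *)
Lemma mcoeff_bform (c : seq int) (j : 'I_11) :
  (bform c Xf Xg)@_(bimon (10 - j) j) = (c`_j)%:~R.
Proof.
have mcoeff_term (z : int) (a b : nat) m :
    (z%:~R * Xf ^+ a * Xg ^+ b)@_m = z%:~R * (bimon a b == m)%:R.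
  (* The integer constant becomes a rational scalar acting on a single monomial, and [mcoeff] is
     linear. *)
  by rewrite -mulrA XfXgE -scaler_int -scalerAl mul1r mcoeffZ mcoeffX.
rewrite /bform raddf_sum /= (bigD1 j) //= mcoeff_term eqxx mulr1.
rewrite big1 ?addr0 // => k neq_kj; rewrite mcoeff_term.
(* The exponent of [Xg] alone determines the index of the term. *)
case: eqP => [/bimon_inj[_ /val_inj e]|_]; last by rewrite mulr0.
by rewrite e eqxx in neq_kj.
Qed.

Lemma mcoeff_bforms (cs : seq (seq int)) (j : 'I_11) :
  [seq p@_(bimon (10 - j) j) | p <- [seq bform c Xf Xg | c <- cs]]
  = [seq n%:~R | n <- [seq c`_j | c <- cs]].
Proof. by rewrite -!map_comp; apply: eq_map => c /=; rewrite mcoeff_bform. Qed.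

(** Taking a coefficient preserves equality of multisets, and the integers embed injectively in
    [rat]. The question thus descends to lists of integers, where it is settled by computation. *)
Lemma perm_bforms_coef (cs ds : seq (seq int)) (j : 'I_11) :
  perm_eq [seq bform c Xf Xg | c <- cs] [seq bform d Xf Xg | d <- ds] ->
  perm_eq [seq c`_j | c <- cs] [seq d`_j | d <- ds].
Proof.
move=> /(perm_map (mcoeff (bimon (10 - j) j))).
by rewrite !mcoeff_bforms; apply: perm_map_inj; apply: intr_inj.
Qed.

(** Both the coefficient map and the embedding of the integers in [rat] are additive, hence commute
    with negation; [map_oppr] is applied once to each. *)
Lemma symmetric_bforms_coef (cs : seq (seq int)) (j : 'I_11) :
  symmetric_multiset [seq bform c Xf Xg | c <- cs] ->
  symmetric_multiset [seq c`_j | c <- cs].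
Proof.
have map_oppr (R S : comNzRingType) (h : {additive R -> S}) (s : seq R) :
    [seq h x | x <- [seq - x | x <- s]] = [seq - y | y <- [seq h x | x <- s]].
  by rewrite -!map_comp; apply: eq_map => x /=; rewrite raddfN.
move=> /(perm_map (mcoeff (bimon (10 - j) j))).
rewrite (map_oppr _ _ (mcoeff (bimon (10 - j) j))) !mcoeff_bforms -(map_oppr int rat intr).
exact/perm_map_inj/intr_inj.
Qed.

Theorem mainTheorem5 :
  (forall f g : rat,
    [/\ \sum_(x <- xs f g) x = 0,
        \sum_(y <- ys f g) y = 0
      & forall r : nat, r \in [:: 1; 2; 3; 4; 5; 7]%N ->
          \sum_(x <- xs f g) x ^+ r = \sum_(y <- ys f g) y ^+ r])
  /\ ~~ perm_eq (xs Xf Xg) (ys Xf Xg)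
  /\ ~~ (symmetric_multiset (xs Xf Xg) && symmetric_multiset (ys Xf Xg)).
Proof.
split=> [f g|].
  split; [exact: sum_xs | exact: sum_ys | move=> r].
  rewrite !inE => /or4P[/eqP->|/eqP->|/eqP->|/or3P[]/eqP->].
  - exact: sum_expr1.
  - exact: sum_expr2.
  - exact: sum_expr3.
  - exact: sum_expr4.
  - exact: sum_expr5.
  - exact: sum_expr7.
have lt9 : (9 < 11)%N by [].
split; apply/negP.
  (* Equal multisets have the same members, but membership of -24 evaluates to true on one side and
     false on the other. *)
  by move=> /(perm_bforms_coef _ _ (Ordinal lt9))/perm_mem/(_ (- 24%:Z)).
(* Symmetry of [xs] would make 24 a coefficient of some form there, since -24 is one. *)
by case/andP=> /(symmetric_bforms_coef _ (Ordinal lt9))/perm_mem/(_ (- 24%:Z)).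
Qed.
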